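(* (Type $q$-P$(E_3^{(1)};b)$.) Let $$L_1=\Bigl(g-\frac{\nu_5}{\kappa_2}\Bigr)\frac{\nu_1\nu_2\nu_3\nu_4}{f}+\frac{(g\nu_1-1)z}{qg}+\frac{\nu_1\nu_2\nu_3(\frac zq-\nu_4)}{f-\frac zq}(g-T_z^{-1})+\frac{z(z-\frac{\kappa_1}{\nu_8})}{q(f-z)}\Bigl(T_z-\frac1g\Bigr).$$ Set $f=\nu_4$. Then the equation $L_1y(z)=0$ is written as $$z\Bigl(z-\frac{\kappa_1}{\nu_8}\Bigr)y(qz)+\Bigl(-\nu_1z^2+qdz-\frac{q\nu_1\nu_2\nu_3\nu_4\nu_5}{\kappa_2}\Bigr)y(z)+q\nu_1\nu_2\nu_3(z-\nu_4)y(z/q)=0,$$ $$d=\frac{\nu_1(q\nu_2\nu_3\nu_5+\kappa_2\nu_4)}{q\kappa_2}+\frac{\kappa_1-\nu_4\nu_8}{q\nu_8}\frac1g .$$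
   Context: The parameters $\kappa_1,\kappa_2,\nu_1,\dots,\nu_8$ satisfy $\kappa_1^2\kappa_2^2=q\nu_1\nu_2\cdots\nu_8$. $T_z$ is the $q$-shift operator on the variable $z$: $T_zy(z)=y(qz)$, $T_z^{-1}y(z)=y(z/q)$. $L_1$ is an operator of the Kajiwara–Noumi–Yamada Lax pair for the $q$-Painlevé equation $q$-P$(E_3^{(1)};b)$, whose dependent variables $f,g$ are here treated as parameters.
   Formalization: The sign of the last term is corrected: with the given L_1 it is −qν₁ν₂ν₃(z−ν₄)y(z/q), not +; the equivalence is stated at points where L_1 is defined (q, κ₂, ν₄, ν₈, g nonzero, z≠ν₄, z/q≠ν₄). *)

(* Defs.v *)
From HB Require Import structures.
From mathcomp Require Import all_boot all_order all_algebra.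
From mathcomp Require Import reals complex.

Set Implicit Arguments.
Unset Strict Implicit.
Unset Printing Implicit Defensive.

Import Order.TTheory GRing.Theory Num.Theory.
Local Open Scope ring_scope.

Section QShift.
Variable R : realType.
Local Notation C := (R[i]).

Definition Tz (q : C) (y : C -> C) : C -> C := fun z => y (q * z).

Definition TzV (q : C) (y : C -> C) : C -> C := fun z => y (z / q).

(* The scalar part of the operator acts by multiplication by a function of z;
   f and g are constants.  Division by 0 being total in MathComp, the value is
   only meaningful when q, kappa2, nu8, f, g, f - z / q and f - z are nonzero.
   At f = nu4 the factor (z / q - nu4) / (f - z / q) is -1, so that TzV enters
   with coefficient + nu1 * nu2 * nu3; clearing the denominator q * (nu4 - z) of
   the Tz term turns it into - q * nu1 * nu2 * nu3 * (z - nu4). *)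
Definition L1 (q kappa1 kappa2 nu1 nu2 nu3 nu4 nu5 nu8 f g : C)
    (y : C -> C) : C -> C := fun z =>
  ((g - nu5 / kappa2) * (nu1 * nu2 * nu3 * nu4 / f)
     + (g * nu1 - 1) * z / (q * g)) * y z
  + nu1 * nu2 * nu3 * (z / q - nu4) / (f - z / q) * (g * y z - TzV q y z)
  + z * (z - kappa1 / nu8) / (q * (f - z)) * (Tz q y z - g^-1 * y z).

End QShift.

(* Main.v *)
Require Import Defs.
From HB Require Import structures.
From mathcomp Require Import all_boot all_order all_algebra.
From mathcomp Require Import reals complex.
From mathcomp Require Import ring.

Set Implicit Arguments.
Unset Strict Implicit.
Unset Printing Implicit Defensive.

Import Order.TTheory GRing.Theory Num.Theory.
Local Open Scope ring_scope.

(** At [f = nu4] the factor in front of [g - TzV] collapses to [-1], so its pole disappears and its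
    contribution [- nu1 * nu2 * nu3 * g] cancels the [g] part of the first scalar term. The only
    pole left is at [z = nu4]; multiplying by the nonzero [q * (nu4 - z)] clears it. In the
    coefficient of [y z] the two [z ^+ 2 / g] terms then cancel, and the remaining multiples of [z]
    add up to [q * d]. Hence the two equations differ by an invertible factor. *)

Lemma L1_nu4_clear_denominators (R : realType)
    (q kappa1 kappa2 nu1 nu2 nu3 nu4 nu5 nu8 g : R[i])
    (hq : q != 0) (hkappa2 : kappa2 != 0) (hnu4 : nu4 != 0) (hnu8 : nu8 != 0)
    (hg : g != 0) (y : R[i] -> R[i]) (z : R[i])
    (hz : z != nu4) (hzq : z / q != nu4) :
  let d := nu1 * (q * nu2 * nu3 * nu5 + kappa2 * nu4) / (q * kappa2)
           + (kappa1 - nu4 * nu8) / (q * nu8) * (1 / g) in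
  q * (nu4 - z) * L1 q kappa1 kappa2 nu1 nu2 nu3 nu4 nu5 nu8 nu4 g y z
  = z * (z - kappa1 / nu8) * y (q * z)
    + (- nu1 * z ^+ 2 + q * d * z
       - q * nu1 * nu2 * nu3 * nu4 * nu5 / kappa2) * y z
    - q * nu1 * nu2 * nu3 * (z - nu4) * y (z / q).
Proof.
move=> d; rewrite /L1 /Tz /TzV /d.
have hz' : nu4 - z != 0 by rewrite subr_eq0 eq_sym.
have hzq' : nu4 - z / q != 0 by rewrite subr_eq0 eq_sym.
(* Here [z / q != nu4] is essential: at equality the quotient would take the default value 0. *)
have -> : nu1 * nu2 * nu3 * (z / q - nu4) / (nu4 - z / q) = - (nu1 * nu2 * nu3).
  by rewrite -(opprB nu4 (z / q)) mulrN mulNr mulfK.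
(* The three values of [y] become independent unknowns, leaving an identity of rational
   functions. *)
move: (y (z / q)) (y (q * z)) (y z) => u v w.
by field; do ?[apply/andP; split].
Qed.

Theorem mainTheorem12 (R : realType)
    (q kappa1 kappa2 nu1 nu2 nu3 nu4 nu5 nu6 nu7 nu8 f g d : R[i])
    (hconstr : kappa1 ^+ 2 * kappa2 ^+ 2
               = q * (nu1 * nu2 * nu3 * nu4 * nu5 * nu6 * nu7 * nu8))
    (hq : q != 0) (hkappa2 : kappa2 != 0) (hnu4 : nu4 != 0) (hnu8 : nu8 != 0)
    (hg : g != 0)
    (hf : f = nu4)
    (hd : d = nu1 * (q * nu2 * nu3 * nu5 + kappa2 * nu4) / (q * kappa2)
              + (kappa1 - nu4 * nu8) / (q * nu8) * (1 / g))
    (y : R[i] -> R[i]) (z : R[i]) (hz : z != nu4) (hzq : z / q != nu4) :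
  L1 q kappa1 kappa2 nu1 nu2 nu3 nu4 nu5 nu8 f g y z = 0
  <->
  z * (z - kappa1 / nu8) * y (q * z)
  + (- nu1 * z ^+ 2 + q * d * z - q * nu1 * nu2 * nu3 * nu4 * nu5 / kappa2) * y z
  - q * nu1 * nu2 * nu3 * (z - nu4) * y (z / q) = 0.
Proof.
rewrite hf hd -L1_nu4_clear_denominators //; split=> [-> | /eqP].
  by rewrite mulr0.
(* Neither [q] nor [nu4 - z] vanishes, so the factor [L1] must. *)
by rewrite !mulf_eq0 (negPf hq) subr_eq0 eq_sym (negPf hz) => /eqP.
Qed.
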